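(* Let $g:\mathbb{R}\to\mathbb{R}$ be twice continuously differentiable and coercive (its limit at $\pm\infty$ is $+\infty$), with exactly three stationary points $y_1<y_2<y_3$ (so $g'(y_1)=g'(y_2)=g'(y_3)=0$), where $y_1$ and $y_3$ are local minima with $g(y_1)>g(y_3)$ and $y_2$ is a local maximum. If $\alpha,\beta>0$ are such that 1. $\alpha\beta\ge C:=\max_{y_1\le y\le y_3}g'(y)$; 2. there exist $m_1,m_2\in\mathbb{R}$ with $m_1<y_1<m_2$ and $g'(m_1)=g'(m_2)=-\alpha\beta$; 3. $-\frac{C}{\alpha}(t_2-t_1)-\beta(\sin t_2-\sin t_1)+m_1\ge m_2$, where $0<t_1\le t_2$ satisfy $\cos t_1=\cos t_2=-C/(\alpha\beta)$; then the time-varying problem $$\inf_{x\in\mathbb{R}} f(x,t):=g(x-\beta\sin t)$$ has no spurious local trajectories.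
   Context: Time $t$ ranges over $[0,T]$, where $T>0$ is the time horizon, and $\alpha>0$ is a fixed regularization parameter. For an unconstrained time-varying problem $\inf_{x\in\mathbb{R}^n} f(x,t)$, $t\in[0,T]$: A local solution at time $t$ is a point satisfying the first-order (KKT) condition $\nabla_x f(x,t)=0$. A continuous local trajectory is a continuously differentiable function $x:[0,T]\to\mathbb{R}^n$ such that $x(0)$ is a local solution at time $0$ and $\dot x(t)=-\frac1\alpha\nabla_x f(x(t),t)$ on $[0,T]$. The region of attraction of a local minimum $x^*(t)$ of $f(\cdot,t)$ at a given time $t$ is the set of all $x_0\in\mathbb{R}^n$ such that the solution of $\frac{d\tilde x(s)}{ds}=-\frac1\alpha\nabla_x f(\tilde x(s),t)$ (with $t$ held fixed), $\tilde x(0)=x_0$, satisfies $\lim_{s\to\infty}\tilde x(s)=x^*(t)$. A continuous local trajectory $x$ is spurious if for all $\bar T<T$ there exists $t\in[\bar T,T]$ such that $x(t)$ does not belong to the region of attraction of a global solution of $f(\cdot,t)$. Accordingly, the problem has no spurious local trajectories if, when initialized at a local solution, any continuous local trajectory $x$ belongs to the region of attraction of a global solution of $f(\cdot,t)$ at all times $t\in[\bar T,T]$ for some constant $\bar T<T$.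
   Formalization: The times t1, t2 of condition 3 are required to lie within the horizon (t2 ≤ T); without this the claim fails for small T, where the trajectory started at y1 has not yet left the well of y1. *)

(* Defs.v *)
(* World: Stdlib reals with Coquelicot. *)
From Stdlib Require Import Reals.
From Coquelicot Require Import Coquelicot.
Open Scope R_scope.

(** Objectives are written [f x t], with the decision variable [x] in R and the
    time [t] second. *)

Definition C2 (g : R -> R) : Prop :=
  forall y : R,
    ex_derive g y /\ ex_derive (Derive g) y /\
    continuous (Derive (Derive g)) y.

Definition coercive (g : R -> R) : Prop :=
  is_lim g p_infty p_infty /\ is_lim g m_infty p_infty.

Definition is_local_min (g : R -> R) (y : R) : Prop :=
  locally y (fun z => g y <= g z).

Definition is_local_max (g : R -> R) (y : R) : Prop :=
  locally y (fun z => g z <= g y).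

Definition is_max_on (h : R -> R) (a b M : R) : Prop :=
  (exists y : R, a <= y <= b /\ h y = M) /\
  (forall y : R, a <= y <= b -> h y <= M).

(** [Derive] is a total operator, so this is the gradient only for objectives
    that are differentiable in [x]. *)
Definition grad_x (f : R -> R -> R) (x t : R) : R :=
  Derive (fun z => f z t) x.

Definition local_solution (f : R -> R -> R) (t x : R) : Prop :=
  grad_x f x t = 0.

Definition global_solution (f : R -> R -> R) (t x : R) : Prop :=
  forall z : R, f x t <= f z t.

(** A trajectory on [0,T] is a total function of which only the values on [0,T]
    matter: [D_in] and [continue_in] are relative to that interval, hence
    one-sided at its endpoints. *)
Definition continuous_local_trajectory
    (alpha T : R) (f : R -> R -> R) (x : R -> R) : Prop :=
  local_solution f 0 (x 0) /\
  exists dx : R -> R,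
    forall t : R, 0 <= t <= T ->
      D_in x dx (fun s => 0 <= s <= T) t /\
      continue_in dx (fun s => 0 <= s <= T) t /\
      dx t = - (1 / alpha) * grad_x f (x t) t.

(** "The" solution of the frozen-time flow is rendered by an existential: it is
    unique as soon as [grad_x f] is locally Lipschitz in [x]. *)
Definition region_of_attraction
    (alpha : R) (f : R -> R -> R) (t xstar : R) (x0 : R) : Prop :=
  exists xt : R -> R,
    xt 0 = x0 /\
    (forall s : R, 0 <= s ->
       D_in xt (fun r => - (1 / alpha) * grad_x f (xt r) t)
            (fun r => 0 <= r) s) /\
    is_lim xt p_infty xstar.

Definition no_spurious_local_trajectories
    (alpha T : R) (f : R -> R -> R) : Prop :=
  forall x : R -> R,
    continuous_local_trajectory alpha T f x ->
    exists Tbar : R, 0 <= Tbar < T /\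
      forall t : R, Tbar <= t <= T ->
        exists xstar : R,
          global_solution f t xstar /\
          region_of_attraction alpha f t xstar (x t).

(* Main.v *)
Require Import Defs.
From Stdlib Require Import Reals Lra Ranalysis5.
From Coquelicot Require Import Coquelicot.
Open Scope R_scope.

(** In the frame of the landscape, [Y t = x t - beta * sin t], a trajectory obeys
    [Y' = - g' (Y) / alpha - beta * cos t] and starts at a critical point of [g].

    Coercivity and the two local minima fix the sign of [g']: negative, positive,
    negative, positive on the four intervals cut out by [y1 < y2 < y3].  Hence
    [y3 + beta * sin t] is the global minimizer at time [t], and its region of
    attraction contains every [x] with [x - beta * sin t > y2].  The flows that
    witness this are obtained by separation of variables
    ([flow_increases_to_zero], [gradient_flow_basin]).

    It remains to see that [Y] ends beyond [y2].  At [m1] and [m2] the force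
    [- g' / alpha] equals [beta] and dominates the drift at every phase, so once
    [Y] is above one of these levels it stays above it ([drift_barrier]).  The
    signs of [g'] place [m2] strictly between [y2] and [y3].  Now [Y] starts above
    [m1], so [Y t1 >= m1].  As long as [Y <= m2 < y3], the gradient force is at
    least [- C / alpha], so [drift_lower_bound] and the displacement hypothesis
    give [Y t2 >= m2].  From [t2] on, [Y >= m2 > y2]. *)

(** * Consequences of the mean value theorem *)

(** Differentiability is asked only inside the interval: trajectories have
    merely one-sided derivatives at the ends of the time horizon. *)
Lemma mean_value (f df : R -> R) (a b : R) :
  a < b ->
  (forall t, a < t < b -> is_derive f t (df t)) ->
  (forall t, a <= t <= b -> continuity_pt f t) ->
  exists c, a < c < b /\ f b - f a = df c * (b - a).
Proof.
intros Hab Hd Hc.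
assert (pr : forall c, a < c < b -> derivable_pt f c).
{ intros c H. exists (df c). apply is_derive_Reals, Hd, H. }
destruct (MVT f id a b pr (fun c _ => derivable_pt_id c) Hab Hc) as (c & P & E).
{ intros c _. apply derivable_continuous_pt, derivable_pt_id. }
exists c; split; [exact P|].
rewrite (derive_pt_eq_0 f c (df c) (pr c P)) in E
  by (apply is_derive_Reals, Hd, P).
rewrite (derive_pt_eq_0 id c 1) in E by apply derivable_pt_lim_id.
unfold id in E. lra.
Qed.

Lemma is_derive_continuity_pt (f : R -> R) (x l : R) :
  is_derive f x l -> continuity_pt f x.
Proof.
intros H. apply continuity_pt_filterlim.
apply (ex_derive_continuous (V := R_NormedModule) f). exists l; exact H.
Qed.

Lemma derive_pos_lt (f : R -> R) (u v : R) :
  (forall z, ex_derive f z) -> u < v ->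
  (forall z, u < z < v -> 0 < Derive f z) -> f u < f v.
Proof.
intros Hf Huv Hp.
destruct (mean_value f (Derive f) u v Huv) as (c & Hc & E).
- intros; apply Derive_correct, Hf.
- intros; apply is_derive_continuity_pt with (Derive f t), Derive_correct, Hf.
- assert (0 < Derive f c * (v - u)) by (apply Rmult_lt_0_compat; [apply Hp; lra|lra]).
  lra.
Qed.

Lemma derive_neg_gt (f : R -> R) (u v : R) :
  (forall z, ex_derive f z) -> u < v ->
  (forall z, u < z < v -> Derive f z < 0) -> f v < f u.
Proof.
intros Hf Huv Hp.
enough (- f u < - f v) by lra.
apply (derive_pos_lt (fun z => - f z)); [|exact Huv|].
- intros z. apply (ex_derive_opp (V := R_NormedModule) f), Hf.
- intros z Hz. rewrite Derive_opp. specialize (Hp z Hz). lra.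
Qed.

Lemma nonvanishing_pos (k : R -> R) (u v : R) :
  continuity k ->
  (forall z, Rmin u v <= z <= Rmax u v -> k z <> 0) ->
  0 < k u -> 0 < k v.
Proof.
intros Hk Hz Hu.
destruct (Rlt_or_le 0 (k v)) as [H|H]; [exact H|].
destruct (IVT_gen k u v 0 Hk) as (z & Hzz & E).
{ rewrite Rmin_right, Rmax_left by lra. lra. }
now elim (Hz z Hzz).
Qed.

Lemma nonvanishing_neg (k : R -> R) (u v : R) :
  continuity k ->
  (forall z, Rmin u v <= z <= Rmax u v -> k z <> 0) ->
  k u < 0 -> k v < 0.
Proof.
intros Hk Hz Hu.
enough (0 < - k v) by lra.
apply (nonvanishing_pos (fun z => - k z) u).
- intros z. apply continuity_pt_opp, Hk.
- intros z H. specialize (Hz z H). lra.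
- lra.
Qed.

(** The gradient is Lipschitz on compact sets only, which is why the two
    places that need a Lipschitz constant first confine the states to an
    interval. *)
Lemma C1_lipschitz (k : R -> R) (a b : R) :
  (forall y, ex_derive k y) -> (forall y, continuous (Derive k) y) ->
  exists L, 0 < L /\
    forall u v, a <= u <= b -> a <= v <= b -> Rabs (k u - k v) <= L * Rabs (u - v).
Proof.
intros Hk Hc.
destruct (Rlt_or_le b a) as [Hba|Hab].
{ exists 1; split; [lra|]. intros; lra. }
destruct (continuity_ab_maj (fun z => Rabs (Derive k z)) a b Hab) as (M & HM & _).
{ intros c _. apply continuity_pt_filterlim.
  apply (continuous_comp (Derive k) Rabs); [apply Hc|apply continuous_Rabs]. }
exists (Rabs (Derive k M) + 1); split; [pose proof (Rabs_pos (Derive k M)); lra|].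
intros u v Hu Hv.
destruct (MVT_gen k v u (Derive k)) as (c & Hc1 & E).
- intros; apply Derive_correct, Hk.
- intros; apply is_derive_continuity_pt with (Derive k x), Derive_correct, Hk.
- rewrite E, Rabs_mult. apply Rmult_le_compat_r; [apply Rabs_pos|].
  enough (Rabs (Derive k c) <= Rabs (Derive k M)) by lra.
  apply HM. revert Hc1. unfold Rmin, Rmax.
  destruct (Rle_dec v u); lra.
Qed.

(** * Barriers for differential inequalities *)

(** Squaring smooths the corner of the positive part at 0, so that the
    violation of a lower bound can be differentiated in time. *)
Lemma is_derive_pos_part_sqr (u : R) :
  is_derive (fun v => Rmax v 0 * Rmax v 0) u (2 * Rmax u 0).
Proof.
destruct (Rtotal_order u 0) as [Hu|[Hu|Hu]].
- apply is_derive_ext_loc with (fun _ => 0).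
  + exists (mkposreal (- u) ltac:(lra)). intros v Hv.
    apply Rabs_def2 in Hv; simpl in Hv; unfold minus, plus, opp in Hv; simpl in Hv.
    rewrite Rmax_right by lra. symmetry. apply Rmult_0_r.
  + rewrite Rmax_right by lra. rewrite Rmult_0_r.
    apply (is_derive_const (V := R_NormedModule)).
- subst u. apply is_derive_Reals. intros eps He.
  exists (mkposreal eps He). intros h Hh Hb. simpl in Hb.
  rewrite Rplus_0_l, (Rmax_right 0 0) by lra.
  unfold Rmax; destruct (Rle_dec h 0).
  + replace ((0 * 0 - 0 * 0) / h - 2 * 0) with 0 by (field; exact Hh).
    rewrite Rabs_R0; exact He.
  + replace ((h * h - 0 * 0) / h - 2 * 0) with h by (field; exact Hh). exact Hb.
- apply is_derive_ext_loc with (fun v => v * v).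
  + exists (mkposreal u Hu). intros v Hv.
    apply Rabs_def2 in Hv; simpl in Hv; unfold minus, plus, opp in Hv; simpl in Hv.
    rewrite Rmax_left by lra. reflexivity.
  + rewrite Rmax_left by lra. auto_derive; [exact I|ring].
Qed.

(** Gronwall's argument: the squared violation [max (m - Y) 0 ^ 2] grows at rate
    at most [2 K], so its product with [exp (- 2 K t)] is nonincreasing; it is
    0 at time [c], hence still 0 at time [d]. *)
Lemma lower_barrier (Y p : R -> R) (c d m K : R) :
  c <= d ->
  (forall t, continuity_pt Y t) ->
  (forall t, c < t < d -> is_derive Y t (p t)) ->
  (forall t, c < t < d -> Y t < m -> - K * (m - Y t) <= p t) ->
  m <= Y c -> m <= Y d.
Proof.
intros Hcd HY Hd Hp Hc.
destruct (Rle_lt_or_eq_dec c d Hcd) as [Hlt|<-]; [|exact Hc].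
set (P := fun t => Rmax (m - Y t) 0).
set (V := fun t => P t * P t * exp (- (2 * K) * t)).
assert (HPc : forall t, continuity_pt (fun s => P s * P s) t).
{ intros t. apply continuity_pt_filterlim.
  apply (continuous_comp (fun s => m - Y s) (fun v => Rmax v 0 * Rmax v 0)).
  - apply (continuous_minus (V := R_NormedModule)); [apply continuous_const|].
    apply continuity_pt_filterlim, HY.
  - apply (ex_derive_continuous (V := R_NormedModule)).
    eexists; apply is_derive_pos_part_sqr. }
destruct (mean_value V
  (fun t => (2 * P t * (- p t) - 2 * K * (P t * P t)) * exp (- (2 * K) * t))
  c d Hlt) as (e & He & E).
- intros t Ht.
  evar_last.
  + apply (is_derive_mult (fun s => P s * P s) (fun s => exp (- (2 * K) * s))).
    * apply (is_derive_comp (fun v => Rmax v 0 * Rmax v 0) (fun s => m - Y s)).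
      -- apply is_derive_pos_part_sqr.
      -- apply (is_derive_minus (V := R_NormedModule)).
         ++ apply (is_derive_const (V := R_NormedModule)).
         ++ apply Hd, Ht.
    * auto_derive; [exact I|reflexivity].
    * intros; apply Rmult_comm.
  + unfold plus, mult, scal, minus, opp, zero; simpl; unfold mult; simpl.
    fold (P t). unfold plus, opp, zero; simpl. unfold zero; simpl. ring.
- intros t _. apply continuity_pt_mult; [apply HPc|].
  apply derivable_continuous_pt. reg.
- assert (V c = 0) as Vc.
  { unfold V, P. rewrite Rmax_right by lra. ring. }
  assert ((2 * P e * - p e - 2 * K * (P e * P e)) <= 0) as Hneg.
  { unfold P. destruct (Rlt_or_le (Y e) m) as [H|H].
    - rewrite Rmax_left by lra. specialize (Hp e He H). nra.
    - rewrite Rmax_right by lra. lra. }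
  assert (V d <= 0) as Vd.
  { pose proof (exp_pos (- (2 * K) * e)).
    enough (0 <= - (2 * P e * - p e - 2 * K * (P e * P e)) * exp (- (2 * K) * e) * (d - c))
      by (rewrite Vc in E; lra).
    apply Rmult_le_pos; [apply Rmult_le_pos|]; lra. }
  destruct (Rle_or_lt m (Y d)) as [H|H]; [exact H|exfalso].
  unfold V, P in Vd. rewrite Rmax_left in Vd by lra.
  pose proof (exp_pos (- (2 * K) * d)).
  assert (0 < (m - Y d) * (m - Y d) * exp (- (2 * K) * d)); [|lra].
  apply Rmult_lt_0_compat; [apply Rmult_lt_0_compat|]; lra.
Qed.

(** * Convergence of scalar autonomous flows *)

(** Separation of variables: the time needed to travel from [x0] to [u] is
    [Phi u], the integral of [1 / h] from [x0] to [u], and the solution is the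
    inverse function of [Phi].  The linear bound on [h] makes the flow no faster
    than [w' = L (b - w)], which never reaches [b]; hence [Phi] is unbounded
    below [b], and its inverse is defined for all nonnegative times.
    Convergence to [b] holds because every [u < b] is passed by time [Phi u]. *)
Lemma flow_increases_to_zero (h : R -> R) (a x0 b L : R) :
  a < x0 < b ->
  (forall v, a < v < b -> continuity_pt h v) ->
  (forall v, a < v < b -> 0 < h v) ->
  (forall v, x0 <= v < b -> h v <= L * (b - v)) ->
  exists z : R -> R,
    z 0 = x0 /\
    (forall s, 0 <= s -> D_in z (fun r => h (z r)) (fun r => 0 <= r) s) /\
    is_lim z p_infty b.
Proof.
intros Hx Hcont Hpos HL.
assert (HLpos : 0 < L).
{ assert (0 < L * (b - x0)) by (specialize (HL x0); specialize (Hpos x0); lra).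
  destruct (Rlt_or_le 0 L); [assumption|nra]. }
assert (Hinv : forall v, a < v < b -> continuous (fun v => / h v) v).
{ intros v Hv. apply continuity_pt_filterlim, continuity_pt_inv.
  - apply Hcont, Hv.
  - specialize (Hpos v Hv); lra. }
set (Phi := fun u => RInt (fun v => / h v) x0 u).
assert (Phi0 : Phi x0 = 0) by (unfold Phi; now rewrite RInt_point).
assert (HPhi : forall u, a < u < b -> is_derive Phi u (/ h u)).
{ intros u Hu. apply (is_derive_RInt (V := R_NormedModule) (fun v => / h v)) with x0.
  - apply (filter_imp (fun w => a < w < b)).
    + intros w Hw. apply (RInt_correct (V := R_CompleteNormedModule)).
      apply (ex_RInt_continuous (V := R_CompleteNormedModule)).
      intros z. unfold Rmin, Rmax; destruct (Rle_dec x0 w); intros; apply Hinv; lra.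
    + apply (locally_interval _ u a b); simpl; intuition.
  - apply Hinv, Hu. }
assert (HPhic : forall u, a < u < b -> continuity_pt Phi u)
  by (intros; eapply is_derive_continuity_pt, HPhi; assumption).
assert (Hmv : forall u v, x0 <= u -> u < v -> v < b ->
  exists c, u < c < v /\ v - u = h c * (Phi v - Phi u)).
{ intros u v Hu Huv Hv.
  destruct (mean_value Phi (fun t => / h t) u v Huv) as (c & Hc & E).
  - intros; apply HPhi; lra.
  - intros; apply HPhic; lra.
  - exists c; split; [exact Hc|]. rewrite E. field.
    specialize (Hpos c); lra. }
assert (Hmono : forall u v, x0 <= u -> u < v -> v < b -> Phi u < Phi v).
{ intros u v Hu Huv Hv. destruct (Hmv u v Hu Huv Hv) as (c & Hc & E).
  specialize (Hpos c). nra. }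
(* The comparison flow [w' = L (b - w)]: the travel time to [w s] is at least
   [s], and [w s < b] always. *)
set (w := fun s => b - (b - x0) * exp (- L * s)).
assert (Hw : forall s, 0 < s -> x0 < w s < b).
{ intros s Hs. unfold w. pose proof (exp_pos (- L * s)).
  assert (exp (- L * s) < exp 0) by (apply exp_increasing; nra).
  rewrite exp_0 in *. nra. }
assert (w0 : w 0 = x0) by (unfold w; rewrite Rmult_0_r, exp_0; ring).
assert (Hw' : forall s, is_derive w s (L * (b - w s))).
{ intros s. unfold w. auto_derive; [exact I|ring]. }
assert (Hunb : forall s, 0 < s -> s <= Phi (w s)).
{ intros s Hs.
  destruct (mean_value (fun t => Phi (w t)) (fun t => L * (b - w t) * / h (w t)) 0 s Hs)
    as (c & Hc & E).
  - intros t Ht. apply (is_derive_comp Phi w); [|apply Hw'].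
    apply HPhi. specialize (Hw t); lra.
  - intros t Ht. apply (continuity_pt_comp w Phi).
    + eapply is_derive_continuity_pt, Hw'.
    + apply HPhic. destruct (Rle_lt_or_eq_dec 0 t) as [H|H]; [lra| |rewrite <- H; lra].
      specialize (Hw t); lra.
  - rewrite w0, Phi0 in E.
    specialize (Hw c ltac:(lra)).
    specialize (HL (w c) ltac:(lra)). specialize (Hpos (w c) ltac:(lra)).
    assert (1 <= L * (b - w c) * / h (w c)); [|nra].
    apply Rmult_le_reg_r with (h (w c)); [exact Hpos|].
    replace (L * (b - w c) * / h (w c) * h (w c)) with (L * (b - w c)) by (field; lra).
    lra. }
assert (Hex : forall s, {u | 0 <= s -> x0 <= u < b /\ Phi u = s}).
{ intros s. destruct (Rle_dec 0 s) as [Hs|Hs]; [|exists 0; lra].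
  (* Time [s + 1] rather than [s] keeps the bracketing interval nondegenerate
     at [s = 0]. *)
  specialize (Hw (s + 1) ltac:(lra)). specialize (Hunb (s + 1) ltac:(lra)).
  destruct (f_interv_is_interv Phi x0 (w (s + 1)) s) as (u & Hu & E).
  - lra.
  - lra.
  - intros; apply HPhic; lra.
  - exists u. intros _. split; [lra|exact E]. }
set (z := fun s => proj1_sig (Hex s)).
assert (Hz : forall s, 0 <= s -> x0 <= z s < b /\ Phi (z s) = s)
  by (intros s; exact (proj2_sig (Hex s))).
assert (Hzgt : forall u s, 0 <= s -> x0 <= u < b -> Phi u < s -> u < z s).
{ intros u s Hs Hu Hlt. destruct (Hz s Hs) as [Hzs E].
  destruct (Rtotal_order u (z s)) as [H|[H|H]]; [exact H|rewrite H in Hlt; lra|].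
  specialize (Hmono (z s) u). lra. }
assert (Hsec : forall s r, 0 <= s -> 0 <= r -> s <> r ->
  exists c, Rabs (c - z s) <= Rabs (z r - z s) /\ x0 <= c < b /\
            z r - z s = h c * (r - s)).
{ intros s r Hs Hr Hsr.
  destruct (Hz s Hs) as [Hzs Es], (Hz r Hr) as [Hzr Er].
  destruct (Rtotal_order (z s) (z r)) as [H|[H|H]].
  - destruct (Hmv (z s) (z r)) as (c & Hc & E); try lra.
    rewrite Es, Er in E. exists c. repeat split; try lra.
    rewrite !Rabs_right; lra.
  - rewrite H in Es. lra.
  - destruct (Hmv (z r) (z s)) as (c & Hc & E); try lra.
    rewrite Es, Er in E. exists c. repeat split; try lra.
    rewrite !Rabs_left; lra. }
exists z. split; [|split].
- destruct (Hz 0 (Rle_refl 0)) as [H E].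
  destruct (Rle_lt_or_eq_dec x0 (z 0)) as [Hlt|He]; [lra| |lra].
  specialize (Hmono x0 (z 0)). lra.
- intros s Hs eps Heps.
  destruct (Hz s Hs) as [Hzs _].
  destruct (Hcont (z s) ltac:(lra) eps Heps) as (delta & Hdelta & Hh).
  (* [M] bounds the speed along the solution, so [z] is [M]-Lipschitz. *)
  set (M := L * (b - x0)).
  assert (0 < M) by (unfold M; nra).
  exists (delta / M). split; [apply Rdiv_lt_0_compat; lra|].
  intros r [[Hr Hne] Hd]. simpl in *. unfold Rdist in *.
  destruct (Hsec s r Hs Hr Hne) as (c & Hc & Hcx & E).
  assert (0 < h c <= M).
  { specialize (HL c Hcx). specialize (Hpos c). unfold M. nra. }
  replace ((z r - z s) / (r - s)) with (h c) by (rewrite E; field; lra).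
  destruct (Req_dec (z s) c) as [<-|Hcz].
  { rewrite Rminus_diag, Rabs_R0. exact Heps. }
  apply Hh. repeat split; [exact Hcz|].
  apply Rle_lt_trans with (1 := Hc). rewrite E, Rabs_mult, (Rabs_right (h c)) by lra.
  apply Rle_lt_trans with (M * Rabs (r - s)).
  + apply Rmult_le_compat_r; [apply Rabs_pos|lra].
  + apply Rmult_lt_reg_r with (/ M); [now apply Rinv_0_lt_compat|].
    replace (M * Rabs (r - s) * / M) with (Rabs (r - s)) by (field; lra).
    exact Hd.
- apply is_lim_spec. intros eps. simpl.
  set (u := Rmax x0 (b - eps / 2)).
  assert (Hu : x0 <= u < b /\ b - eps / 2 <= u).
  { pose proof (cond_pos eps). unfold u, Rmax. destruct (Rle_dec x0 (b - eps / 2)); lra. }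
  exists (Rmax 0 (Phi u)). intros s Hs.
  pose proof (Rmax_l 0 (Phi u)). pose proof (Rmax_r 0 (Phi u)).
  destruct (Hz s) as [Hzs _]; [lra|].
  specialize (Hzgt u s ltac:(lra) ltac:(lra) ltac:(lra)).
  pose proof (cond_pos eps). apply Rabs_def1; lra.
Qed.

Lemma D_in_opp (z dz : R -> R) (D : R -> Prop) (s : R) :
  D_in z dz D s -> D_in (fun r => - z r) (fun r => - dz r) D s.
Proof. exact (Dopp D z dz s). Qed.

Lemma D_in_shift (z dz : R -> R) (D : R -> Prop) (e s : R) :
  D_in z dz D s -> D_in (fun r => z r + e) dz D s.
Proof.
intros H eps Heps. destruct (H eps Heps) as (d & Hd & Hlim).
exists d; split; [exact Hd|]. intros r Hr.
replace (z r + e - (z s + e)) with (z r - z s) by ring.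
exact (Hlim r Hr).
Qed.

(** The reflection [v |-> - v] exchanges the two directions of motion. *)
Lemma flow_decreases_to_zero (h : R -> R) (b x0 a L : R) :
  b < x0 < a ->
  (forall v, b < v < a -> continuity_pt h v) ->
  (forall v, b < v < a -> h v < 0) ->
  (forall v, b < v <= x0 -> - h v <= L * (v - b)) ->
  exists z : R -> R,
    z 0 = x0 /\
    (forall s, 0 <= s -> D_in z (fun r => h (z r)) (fun r => 0 <= r) s) /\
    is_lim z p_infty b.
Proof.
intros Hx Hcont Hneg HL.
destruct (flow_increases_to_zero (fun v => - h (- v)) (- a) (- x0) (- b) L)
  as (z & z0 & Hz & Hlim).
- lra.
- intros v Hv. apply continuity_pt_opp, (continuity_pt_comp Ropp h).
  + apply derivable_continuous_pt. reg.
  + apply Hcont; lra.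
- intros v Hv. specialize (Hneg (- v)). lra.
- intros v Hv. specialize (HL (- v)). lra.
- exists (fun s => - z s). split; [lra|split].
  + intros s Hs eps Heps. specialize (Hz s Hs). apply D_in_opp in Hz.
    destruct (Hz eps Heps) as (d & Hd & H). exists d; split; [exact Hd|].
    intros r Hr. specialize (H r Hr). rewrite Ropp_involutive in H. exact H.
  + apply is_lim_opp in Hlim. simpl in Hlim. rewrite Ropp_involutive in Hlim. exact Hlim.
Qed.

(** * The shape of a double-well function *)

Lemma C2_derive_continuity (g : R -> R) : C2 g -> continuity (Derive g).
Proof.
intros Hg y. apply is_derive_continuity_pt with (Derive (Derive g) y).
apply Derive_correct, Hg.
Qed.

(** By continuity the derivative has a constant sign past the last critical
    point, and a negative sign would keep [g] bounded above near infinity. *)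
Lemma derive_pos_right_of_last_critical (g : R -> R) (c : R) :
  C2 g -> is_lim g p_infty p_infty ->
  (forall z, c < z -> Derive g z <> 0) ->
  forall z, c < z -> 0 < Derive g z.
Proof.
intros Hg Hlim Hne z Hz.
destruct (Rlt_or_le 0 (Derive g z)) as [H|H]; [exact H|exfalso].
assert (Hneg : forall v, z < v -> Derive g v < 0).
{ intros v Hv. apply (nonvanishing_neg (Derive g) z).
  - apply C2_derive_continuity, Hg.
  - rewrite Rmin_left by lra. intros; apply Hne; lra.
  - specialize (Hne z Hz). lra. }
apply is_lim_spec in Hlim. destruct (Hlim (g z)) as (M & HM).
pose proof (Rmax_l M z). pose proof (Rmax_r M z).
specialize (HM (Rmax M z + 1) ltac:(lra)).
assert (g (Rmax M z + 1) < g z); [|lra].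
apply derive_neg_gt; [intro; apply Hg|lra|]. intros; apply Hneg; lra.
Qed.

Lemma derive_neg_left_of_first_critical (g : R -> R) (c : R) :
  C2 g -> is_lim g m_infty p_infty ->
  (forall z, z < c -> Derive g z <> 0) ->
  forall z, z < c -> Derive g z < 0.
Proof.
intros Hg Hlim Hne z Hz.
destruct (Rlt_or_le (Derive g z) 0) as [H|H]; [exact H|exfalso].
assert (Hpos : forall v, v < z -> 0 < Derive g v).
{ intros v Hv. apply (nonvanishing_pos (Derive g) z).
  - apply C2_derive_continuity, Hg.
  - rewrite Rmax_left by lra. intros; apply Hne; lra.
  - specialize (Hne z Hz). lra. }
apply is_lim_spec in Hlim. destruct (Hlim (g z)) as (M & HM).
pose proof (Rmin_l M z). pose proof (Rmin_r M z).
specialize (HM (Rmin M z - 1) ltac:(lra)).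
assert (g (Rmin M z - 1) < g z); [|lra].
apply derive_pos_lt; [intro; apply Hg|lra|]. intros; apply Hpos; lra.
Qed.

(** The derivative has a constant sign between critical points; were it
    positive, [g] would increase strictly up to [v]. *)
Lemma derive_neg_left_of_local_min (g : R -> R) (u v : R) :
  C2 g -> is_local_min g v ->
  (forall z, u < z < v -> Derive g z <> 0) ->
  forall z, u < z < v -> Derive g z < 0.
Proof.
intros Hg [d Hd] Hne z Hz.
destruct (Rlt_or_le (Derive g z) 0) as [H|H]; [exact H|exfalso].
assert (Hpos : forall w, z < w < v -> 0 < Derive g w).
{ intros w Hw. apply (nonvanishing_pos (Derive g) z).
  - apply C2_derive_continuity, Hg.
  - rewrite Rmin_left, Rmax_right by lra. intros; apply Hne; lra.
  - specialize (Hne z Hz). lra. }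
pose proof (cond_pos d).
set (w := Rmax ((z + v) / 2) (v - d / 2)).
assert (Hw : z < w < v /\ v - d / 2 <= w)
  by (unfold w, Rmax; destruct (Rle_dec ((z + v) / 2) (v - d / 2)); lra).
assert (g v <= g w).
{ apply Hd. apply Rabs_def1; unfold minus, plus, opp; simpl; lra. }
assert (g w < g v); [|lra].
apply derive_pos_lt; [intro; apply Hg|lra|]. intros; apply Hpos; lra.
Qed.

Lemma derive_pos_right_of_local_min (g : R -> R) (v u : R) :
  C2 g -> is_local_min g v ->
  (forall z, v < z < u -> Derive g z <> 0) ->
  forall z, v < z < u -> 0 < Derive g z.
Proof.
intros Hg [d Hd] Hne z Hz.
destruct (Rlt_or_le 0 (Derive g z)) as [H|H]; [exact H|exfalso].
assert (Hneg : forall w, v < w < z -> Derive g w < 0).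
{ intros w Hw. apply (nonvanishing_neg (Derive g) z).
  - apply C2_derive_continuity, Hg.
  - rewrite Rmin_right, Rmax_left by lra. intros; apply Hne; lra.
  - specialize (Hne z Hz). lra. }
pose proof (cond_pos d).
set (w := Rmin ((z + v) / 2) (v + d / 2)).
assert (Hw : v < w < z /\ w <= v + d / 2)
  by (unfold w, Rmin; destruct (Rle_dec ((z + v) / 2) (v + d / 2)); lra).
assert (g v <= g w).
{ apply Hd. apply Rabs_def1; unfold minus, plus, opp; simpl; lra. }
assert (g w < g v); [|lra].
apply derive_neg_gt; [intro; apply Hg|lra|]. intros; apply Hneg; lra.
Qed.

Lemma double_well_global_min (g : R -> R) (y1 y2 y3 : R) :
  (forall y, ex_derive g y) ->
  (forall y, y < y1 -> Derive g y < 0) ->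
  (forall y, y1 < y < y2 -> 0 < Derive g y) ->
  (forall y, y2 < y < y3 -> Derive g y < 0) ->
  (forall y, y3 < y -> 0 < Derive g y) ->
  g y3 < g y1 ->
  forall y, g y3 <= g y.
Proof.
intros Hg H1 H2 H3 H4 H13 y.
destruct (Rle_or_lt y y2) as [Hy|Hy].
- apply Rlt_le, Rlt_le_trans with (1 := H13).
  destruct (Rtotal_order y y1) as [Hlt|[->|Hgt]]; [apply Rlt_le| lra |apply Rlt_le].
  + apply derive_neg_gt; [exact Hg|exact Hlt|]. intros; apply H1; lra.
  + apply derive_pos_lt; [exact Hg|exact Hgt|]. intros; apply H2; lra.
- destruct (Rtotal_order y y3) as [Hlt|[->|Hgt]]; [apply Rlt_le| lra |apply Rlt_le].
  + apply derive_neg_gt; [exact Hg|exact Hlt|]. intros; apply H3; lra.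
  + apply derive_pos_lt; [exact Hg|exact Hgt|]. intros; apply H4; lra.
Qed.

(** * Basins of attraction of the gradient flow *)

(** The state moves monotonically towards the zero [b] of [k], from either side.
    The local Lipschitz bound on [k] supplies the linear bound near [b] under
    which the solution exists for all time. *)
Lemma gradient_flow_basin (k : R -> R) (alpha a b z0 : R) :
  0 < alpha ->
  (forall y, ex_derive k y) -> (forall y, continuous (Derive k) y) ->
  k b = 0 -> a < b ->
  (forall y, a < y < b -> k y < 0) ->
  (forall y, b < y -> 0 < k y) ->
  a < z0 ->
  exists z : R -> R,
    z 0 = z0 /\
    (forall s, 0 <= s ->
       D_in z (fun r => - (1 / alpha) * k (z r)) (fun r => 0 <= r) s) /\
    is_lim z p_infty b.
Proof.
intros Hal Hk Hk' Hb Hab Hneg Hpos Hz0.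
assert (Hia : 0 < 1 / alpha) by (apply Rdiv_lt_0_compat; lra).
assert (Hc : continuity (fun y => - (1 / alpha) * k y)).
{ intros y. apply continuity_pt_scal.
  apply is_derive_continuity_pt with (Derive k y), Derive_correct, Hk. }
destruct (C1_lipschitz k (Rmin z0 b) (Rmax z0 b) Hk Hk') as (L & HL & Hlip).
destruct (Rtotal_order z0 b) as [Hlt|[->|Hgt]].
- apply (flow_increases_to_zero (fun y => - (1 / alpha) * k y) a z0 b (1 / alpha * L)).
  + lra.
  + intros; apply Hc.
  + intros v Hv. specialize (Hneg v Hv). nra.
  + intros v Hv. rewrite Rmin_left, Rmax_right in Hlip by lra.
    specialize (Hlip v b). rewrite Hb, Rabs_left1, Rabs_left1 in Hlip;
      [|lra|specialize (Hneg v); lra].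
    rewrite Rmult_assoc.
    replace (- (1 / alpha) * k v) with (1 / alpha * - k v) by ring.
    apply Rmult_le_compat_l; lra.
- exists (fun _ => b). split; [reflexivity|split; [|apply is_lim_const]].
  intros s Hs. rewrite Hb, Rmult_0_r. exact (Dconst (fun r => 0 <= r) b s).
- apply (flow_decreases_to_zero (fun y => - (1 / alpha) * k y) b z0 (z0 + 1) (1 / alpha * L)).
  + lra.
  + intros; apply Hc.
  + intros v Hv. specialize (Hpos v). nra.
  + intros v Hv. rewrite Rmin_right, Rmax_left in Hlip by lra.
    specialize (Hlip v b). rewrite Hb, Rabs_right, Rabs_right in Hlip;
      [|lra|specialize (Hpos v); lra].
    rewrite Rmult_assoc.
    replace (- (- (1 / alpha) * k v)) with (1 / alpha * k v) by ring.
    apply Rmult_le_compat_l; lra.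
Qed.

(** * Trajectories under the oscillating drift *)

(** Freezing the function outside [0,T] turns one-sided continuity at the
    endpoints into plain continuity, at no cost inside the interval. *)
Lemma D_in_interval_extension (x dx : R -> R) (T : R) :
  0 <= T ->
  (forall t, 0 <= t <= T -> D_in x dx (fun s => 0 <= s <= T) t) ->
  exists X : R -> R,
    (forall t, 0 <= t <= T -> X t = x t) /\
    continuity X /\
    (forall t, 0 < t < T -> is_derive X t (dx t)).
Proof.
intros HT Hx.
set (clamp := fun t => Rmax 0 (Rmin t T)).
assert (Hin : forall t, 0 <= clamp t <= T).
{ intros t. unfold clamp, Rmax, Rmin.
  destruct (Rle_dec t T), (Rle_dec 0 _); lra. }
assert (Hid : forall t, 0 <= t <= T -> clamp t = t).
{ intros t Ht. unfold clamp. rewrite Rmin_left, Rmax_right; lra. }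
assert (Hcontr : forall s t, Rabs (clamp s - clamp t) <= Rabs (s - t)).
{ intros s t. unfold clamp, Rmin.
  destruct (Rle_dec t T), (Rle_dec s T); unfold Rmax;
    repeat match goal with |- context [Rle_dec ?a ?b] => destruct (Rle_dec a b) end;
    unfold Rabs;
    repeat match goal with |- context [Rcase_abs ?a] => destruct (Rcase_abs a) end;
    lra. }
exists (fun t => x (clamp t)). split; [|split].
- intros t Ht. now rewrite Hid.
- intros t eps Heps.
  destruct (cont_deriv x dx _ _ (Hx (clamp t) (Hin t)) eps Heps) as (d & Hd & H).
  exists d; split; [exact Hd|]. intros s [_ Hs]. simpl in *. unfold Rdist in *.
  destruct (Req_dec (clamp t) (clamp s)) as [E|E].
  + rewrite E, Rminus_diag, Rabs_R0. exact Heps.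
  + apply H. repeat split; try apply Hin; [exact E|].
    apply Rle_lt_trans with (2 := Hs), Hcontr.
- intros t Ht. apply is_derive_Reals. intros eps Heps.
  destruct (Hx t ltac:(lra) eps Heps) as (d & Hd & H).
  assert (Hmin : 0 < Rmin d (Rmin t (T - t))) by (repeat apply Rmin_glb_lt; lra).
  exists (mkposreal _ Hmin). intros h Hh Hlt. simpl in Hlt.
  pose proof (Rmin_l d (Rmin t (T - t))). pose proof (Rmin_r d (Rmin t (T - t))).
  pose proof (Rmin_l t (T - t)). pose proof (Rmin_r t (T - t)).
  pose proof (Rle_abs h). pose proof (Rle_abs (- h)) as Hno. rewrite Rabs_Ropp in Hno.
  rewrite !Hid by lra.
  specialize (H (t + h)). simpl in H. unfold Rdist in H.
  replace (t + h - t) with h in H by ring.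
  apply H. repeat split; lra.
Qed.

(** At the level [m] the gradient force [- k m / alpha] equals [beta], the largest
    value that [beta * cos t] can take, so the velocity there is nonnegative.
    Since it may vanish, the bound needs the Gronwall argument of
    [lower_barrier] and not only the sign of the velocity. *)
Lemma drift_barrier (k Y : R -> R) (alpha beta m s e : R) :
  0 < alpha -> 0 < beta ->
  (forall y, ex_derive k y) -> (forall y, continuous (Derive k) y) ->
  continuity Y ->
  (forall t, s < t < e -> is_derive Y t (- (1 / alpha) * k (Y t) - beta * cos t)) ->
  k m = - (alpha * beta) ->
  s <= e -> m <= Y s -> m <= Y e.
Proof.
intros Hal Hbe Hk Hk' HY Hd Hm Hse Hs.
assert (Hia : 0 < 1 / alpha) by (apply Rdiv_lt_0_compat; lra).
destruct (continuity_ab_min Y s e Hse (fun c _ => HY c)) as (q & Hq & _).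
destruct (C1_lipschitz k (Y q) m Hk Hk') as (L & HL & Hlip).
apply (lower_barrier Y (fun t => - (1 / alpha) * k (Y t) - beta * cos t) s e m
         (1 / alpha * L) Hse HY Hd); [|exact Hs].
intros t Ht HYm.
pose proof (Hq t ltac:(lra)).
specialize (Hlip (Y t) m ltac:(lra) ltac:(lra)).
rewrite Hm, (Rabs_left1 (Y t - m)) in Hlip by lra.
pose proof (Rle_abs (k (Y t) - - (alpha * beta))).
pose proof (COS_bound t).
assert (beta * cos t <= beta) by nra.
assert (1 / alpha * k (Y t) <= 1 / alpha * (L * (m - Y t) - alpha * beta)) as Hk_le
  by (apply Rmult_le_compat_l; lra).
replace (1 / alpha * (L * (m - Y t) - alpha * beta))
  with (1 / alpha * L * (m - Y t) - beta) in Hk_le by (field; lra).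
cbv beta. lra.
Qed.

(** Adding [beta * sin t] cancels the drift and leaves a function that decreases
    at rate at most [C / alpha]. *)
Lemma drift_lower_bound (k Y : R -> R) (alpha beta C s e : R) :
  0 < alpha ->
  continuity Y ->
  (forall t, s < t < e -> is_derive Y t (- (1 / alpha) * k (Y t) - beta * cos t)) ->
  (forall t, s < t < e -> k (Y t) <= C) ->
  s <= e ->
  Y s - C / alpha * (e - s) - beta * (sin e - sin s) <= Y e.
Proof.
intros Hal HY Hd HC Hse.
destruct (Rle_lt_or_eq_dec s e Hse) as [Hlt|<-]; [|lra].
assert (Hia : 0 < 1 / alpha) by (apply Rdiv_lt_0_compat; lra).
destruct (mean_value (fun t => Y t + beta * sin t)
  (fun t => - (1 / alpha) * k (Y t)) s e Hlt) as (c & Hc & E).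
- intros t Ht. evar_last.
  + apply (is_derive_plus (V := R_NormedModule) Y (fun t => beta * sin t)).
    * apply Hd, Ht.
    * auto_derive; [exact I|reflexivity].
  + unfold plus; simpl. ring.
- intros t _. apply continuity_pt_plus; [apply HY|].
  apply derivable_continuous_pt. reg.
- specialize (HC c Hc).
  assert (1 / alpha * k (Y c) <= C / alpha).
  { replace (C / alpha) with (1 / alpha * C) by (field; lra).
    apply Rmult_le_compat_l; lra. }
  nra.
Qed.

Lemma grad_x_translate (g c : R -> R) (x t : R) :
  grad_x (fun x t => g (x - c t)) x t = Derive g (x - c t).
Proof.
unfold grad_x. rewrite (Derive_ext _ (fun z => g (z + - c t))) by reflexivity.
unfold Derive. f_equal. apply Lim_ext. intros h. do 2 f_equal. f_equal. ring.
Qed.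

Theorem proposition1
  (T alpha beta : R) (g : R -> R) (y1 y2 y3 C m1 m2 t1 t2 : R)
  (hT : 0 < T) (halpha : 0 < alpha) (hbeta : 0 < beta)
  (hg : C2 g) (hcoer : coercive g)
  (hy12 : y1 < y2) (hy23 : y2 < y3)
  (hstat : forall y : R, Derive g y = 0 <-> (y = y1 \/ y = y2 \/ y = y3))
  (hmin1 : is_local_min g y1) (hmax2 : is_local_max g y2)
  (hmin3 : is_local_min g y3) (hg13 : g y1 > g y3)
  (hC : is_max_on (Derive g) y1 y3 C)
  (h1 : alpha * beta >= C)
  (hm1 : m1 < y1) (hm2 : y1 < m2)
  (hgm1 : Derive g m1 = - (alpha * beta))
  (hgm2 : Derive g m2 = - (alpha * beta))
  (ht1 : 0 < t1) (ht12 : t1 <= t2) (ht2 : t2 <= T)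
  (hcos1 : cos t1 = - C / (alpha * beta))
  (hcos2 : cos t2 = - C / (alpha * beta))
  (h3 : - (C / alpha) * (t2 - t1) - beta * (sin t2 - sin t1) + m1 >= m2) :
  no_spurious_local_trajectories alpha T
    (fun x t : R => g (x - beta * sin t)).
Proof.
assert (Hab : 0 < alpha * beta) by (apply Rmult_lt_0_compat; assumption).
assert (Hne : forall z, z <> y1 -> z <> y2 -> z <> y3 -> Derive g z <> 0)
  by (intros z ? ? ? E; apply hstat in E; tauto).
assert (S1 : forall y, y < y1 -> Derive g y < 0).
{ apply derive_neg_left_of_first_critical; [exact hg|apply hcoer|].
  intros; apply Hne; lra. }
assert (S2 : forall y, y1 < y < y2 -> 0 < Derive g y).
{ apply derive_pos_right_of_local_min; [exact hg|exact hmin1|].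
  intros; apply Hne; lra. }
assert (S3 : forall y, y2 < y < y3 -> Derive g y < 0).
{ apply derive_neg_left_of_local_min; [exact hg|exact hmin3|].
  intros; apply Hne; lra. }
assert (S4 : forall y, y3 < y -> 0 < Derive g y).
{ apply derive_pos_right_of_last_critical; [exact hg|apply hcoer|].
  intros; apply Hne; lra. }
assert (Hglob : forall y, g y3 <= g y).
{ apply (double_well_global_min g y1 y2 y3); try assumption. intro; apply hg. }
assert (Hm2 : y2 < m2 < y3).
{ assert (~ (y1 < m2 < y2)) by (intro Hm; specialize (S2 _ Hm); lra).
  assert (~ y3 < m2) by (intro Hm; specialize (S4 _ Hm); lra).
  assert (Derive g m2 <> 0) as Hm by lra.
  assert (m2 <> y2 /\ m2 <> y3) by (split; intros ->; apply Hm, hstat; tauto).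
  lra. }
assert (HCle : forall y, y <= y3 -> Derive g y <= C).
{ intros y Hy. destruct (Rlt_or_le y y1) as [H|H].
  - specialize (S1 y H). destruct hC as [_ HC].
    specialize (HC y1 ltac:(lra)). assert (Derive g y1 = 0) by (apply hstat; tauto). lra.
  - apply hC; lra. }
intros x (Hx0 & dx & Hx).
unfold local_solution in Hx0. rewrite (grad_x_translate g (fun t => beta * sin t)) in Hx0.
rewrite sin_0, Rmult_0_r, Rminus_0_r in Hx0.
destruct (D_in_interval_extension x dx T ltac:(lra)) as (X & HX & HXc & HXd).
{ intros t Ht. apply Hx, Ht. }
(* The position relative to the moving landscape. *)
set (Y := fun t => X t - beta * sin t).
assert (HYc : continuity Y).
{ intros t. apply continuity_pt_minus; [apply HXc|].
  apply derivable_continuous_pt. reg. }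
assert (HYd : forall t, 0 < t < T ->
  is_derive Y t (- (1 / alpha) * Derive g (Y t) - beta * cos t)).
{ intros t Ht. evar_last.
  - apply (is_derive_minus (V := R_NormedModule) X (fun t => beta * sin t)).
    + apply HXd, Ht.
    + auto_derive; [exact I|reflexivity].
  - destruct (Hx t ltac:(lra)) as (_ & _ & ->).
    rewrite (grad_x_translate g (fun t => beta * sin t)), <- HX by lra.
    unfold minus, plus, opp, Y; simpl. ring. }
assert (Hbar : forall m s e, Derive g m = - (alpha * beta) ->
  0 <= s -> s <= e -> e <= T -> m <= Y s -> m <= Y e).
{ intros m s e Hm Hs Hse He.
  apply (drift_barrier (Derive g) Y alpha beta); try assumption.
  - intro; apply hg.
  - intro; apply hg.
  - intros; apply HYd; lra. }
assert (HY0 : m1 <= Y 0).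
{ unfold Y. rewrite HX, sin_0, Rmult_0_r, Rminus_0_r by lra.
  apply hstat in Hx0. lra. }
(* If [Y] were still below [m2] at time [t2], it would lie in [m1, m2] on all of
   [t1, t2], and the worst-case displacement over that interval would already
   carry it past [m2]. *)
assert (HYt2 : m2 <= Y t2).
{ destruct (Rle_or_lt m2 (Y t2)) as [H|H]; [exact H|].
  assert (Hlow : forall t, t1 <= t <= t2 -> Y t < m2).
  { intros t Ht. destruct (Rle_or_lt m2 (Y t)) as [Ht'|Ht']; [|exact Ht'].
    specialize (Hbar m2 t t2 hgm2). lra. }
  pose proof (Hbar m1 0 t1 hgm1 ltac:(lra) ltac:(lra) ltac:(lra) HY0).
  pose proof (drift_lower_bound (Derive g) Y alpha beta C t1 t2 halpha HYc) as D.
  enough (Y t1 - C / alpha * (t2 - t1) - beta * (sin t2 - sin t1) <= Y t2) by lra.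
  apply D; [| |exact ht12].
  - intros; apply HYd; lra.
  - intros t Ht. apply HCle. specialize (Hlow t). lra. }
(* When [t2 = T], the strict inequality [y2 < m2 <= Y T] leaves room for a final
   interval by continuity. *)
assert (Hend : exists Tbar, 0 <= Tbar < T /\ forall t, Tbar <= t <= T -> y2 < Y t).
{ destruct (Rle_lt_or_eq_dec t2 T ht2) as [Hlt|E].
  - exists t2. split; [lra|]. intros t Ht.
    specialize (Hbar m2 t2 t hgm2). lra.
  - subst t2.
    destruct (HYc T (Y T - y2) ltac:(lra)) as (d & Hd & H).
    exists (Rmax 0 (T - d / 2)). split.
    { split; [apply Rmax_l|apply Rmax_lub_lt; lra]. }
    intros t [Ht HtT].
    pose proof (Rmax_l 0 (T - d / 2)). pose proof (Rmax_r 0 (T - d / 2)).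
    destruct (Rle_lt_or_eq_dec t T HtT) as [Hlt|E]; [|rewrite E; lra].
    specialize (H t). simpl in H. unfold Rdist in H.
    assert (Rabs (Y t - Y T) < Y T - y2) as Habs.
    { apply H. repeat split; [lra|]. rewrite Rabs_left; lra. }
    apply Rabs_def2 in Habs. lra. }
destruct Hend as (Tbar & HTbar & HYend).
exists Tbar. split; [exact HTbar|]. intros t Ht.
exists (y3 + beta * sin t). split.
- intros z. replace (y3 + beta * sin t - beta * sin t) with y3 by ring. apply Hglob.
- destruct (gradient_flow_basin (Derive g) alpha y2 y3 (Y t)) as (z & Hz0 & Hz & Hlim);
    try assumption.
  + intro; apply hg.
  + intro; apply hg.
  + apply hstat; tauto.
  + apply HYend, Ht.
  + exists (fun s => z s + beta * sin t). split; [|split].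
    * rewrite Hz0. unfold Y. rewrite HX by lra. ring.
    * intros s Hs. unfold D_in. rewrite (grad_x_translate g (fun t => beta * sin t)).
      replace (z s + beta * sin t - beta * sin t) with (z s) by ring.
      exact (D_in_shift _ _ _ _ _ (Hz s Hs)).
    * apply (is_lim_plus z (fun _ => beta * sin t) p_infty y3 (beta * sin t));
        [exact Hlim|apply is_lim_const|reflexivity].
Qed.
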